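(* Let $\sigma\colon(\mathcal M,L)\to(\mathcal B,\tilde L)$ be a pseudo-Finsler submersion, with $L\colon\mathcal A\to\mathbb R$, $\tilde L\colon\tilde{\mathcal A}\to\mathbb R$, and let $p\in\mathcal M$. If the Legendre map $\mathcal L_p$ of $L$ at $p$ is injective (respectively bijective), then for each $\tilde v\in\tilde{\mathcal A}\cap T_{\sigma(p)}\mathcal B$ there is at most one (respectively exactly one) horizontal vector $v\in T_p\mathcal M$ satisfying $d\sigma(v)=\tilde v$.
   Context: A pseudo-Finsler metric on $\mathcal M$ is a smooth $L\colon\mathcal A\to\mathbb R$, $\mathcal A\subset T\mathcal M\setminus\mathbf 0$ open and invariant under positive scalar multiplication, with $L(\lambda v)=\lambda^2L(v)$ for $\lambda>0$ and with non-degenerate fundamental tensor $g_v(e,h)=\frac12\frac{\partial^2}{\partial s\partial t}L(v+se+th)|_{s=t=0}$ for every $v\in\mathcal A$ (elements of $\mathcal A$ are called admissible). The Legendre map at $p$ is $\mathcal L_p(v)=g_v(v,\cdot)\in T_p^*\mathcal M$ for $v\in\mathcal A\cap T_p\mathcal M$; bijectivity is understood onto $T^*_p\mathcal M\setminus\{0\}$. Let $\sigma\colon\mathcal M\to\mathcal B$ be a surjective map with surjective differential; vertical vectors at $p$ are the elements of $\mathcal V_p=\ker d\sigma_p$. An admissible $v\in T_p\mathcal M$ is horizontal if $g_v(v,w)=0$ for all $w\in\mathcal V_p$. $\sigma\colon(\mathcal M,L)\to(\mathcal B,\tilde L)$ is a pseudo-Finsler submersion if (i) the restriction of $L$ to the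 tangent spaces of the fibers is a pseudo-Finsler metric on each fiber, and (ii) $L(v)=\tilde L(d\sigma(v))$ for every horizontal $v$ (in particular $d\sigma(v)\in\tilde{\mathcal A}$). For every horizontal $v$ the vertical space $\mathcal V_p$ is $g_v$-non-degenerate. *)

(* Defs.v *)
From HB Require Import structures.
From mathcomp Require Import all_boot all_order all_algebra.
From mathcomp Require Import all_classical all_reals all_analysis.

Set Implicit Arguments.
Unset Strict Implicit.
Unset Printing Implicit Defensive.

Import Order.TTheory GRing.Theory Num.Theory.
Import numFieldNormedType.Exports.

Local Open Scope classical_set_scope.
Local Open Scope ring_scope.

(* Smooth manifolds are Hausdorff second countable spaces with a C^oo atlas and
   a preferred chart around each point. *)

Section Smooth.
Variables (R : realType) (V W : normedModType R).

(* U is meant to be open, so that only the values of f on U matter. *)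
Fixpoint Ck (k : nat) (U : set V) (f : V -> W) : Prop :=
  match k with
  | 0%N => forall x, U x -> {for x, continuous f}
  | k'.+1 => (forall x, U x -> differentiable f x) /\
             (forall v : V, Ck k' U ('D_v f))
  end.

Definition smooth_on (U : set V) (f : V -> W) : Prop := forall k, Ck k U f.

End Smooth.

(* Charts are total functions in both directions; only the values of ch_map on
   ch_dom and those of ch_inv on ch_cod are meaningful. *)
Record chart (R : realType) (n : nat) (X : topologicalType) := Chart {
  ch_dom : set X;
  ch_map : X -> 'rV[R]_n;
  ch_inv : 'rV[R]_n -> X;
  ch_dom_open : open ch_dom;
  ch_cod_open : open (ch_map @` ch_dom);
  ch_mapK : forall p, ch_dom p -> ch_inv (ch_map p) = p;
  ch_map_cont : forall p, ch_dom p -> {for p, continuous ch_map};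
  ch_inv_cont : forall x, (ch_map @` ch_dom) x -> {for x, continuous ch_inv}
}.

Definition ch_cod (R : realType) (n : nat) (X : topologicalType)
    (c : chart R n X) : set 'rV[R]_n :=
  ch_map c @` ch_dom c.

Record manifold (R : realType) (n : nat) := Manifold {
  mspace :> topologicalType;
  m_hausdorff : hausdorff_space mspace;
  m_second_countable : @second_countable mspace;
  atlas : set (chart R n mspace);
  atlas_compat : forall c d, atlas c -> atlas d ->
    smooth_on (ch_cod c `&` ch_inv c @^-1` ch_dom d) (ch_map d \o ch_inv c);
  chart_at : mspace -> chart R n mspace;
  chart_at_atlas : forall p, atlas (chart_at p);
  chart_at_dom : forall p, ch_dom (chart_at p) p
}.

Arguments atlas {R n} m.
Arguments chart_at {R n} m p.

(* T_p M, identified with R^n through the preferred chart at p. *)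
Definition tangent (R : realType) (n : nat) (M : manifold R n) (p : M) :
  normedModType R := 'rV[R]_n.

Definition mcoord (R : realType) (n : nat) (M : manifold R n) (p : M) :
  'rV[R]_n := ch_map (chart_at M p) p.

(* The tangent vector at ch_inv c x whose components in the chart c are w. *)
Definition tangent_of (R : realType) (n : nat) (M : manifold R n)
    (c : chart R n M) (x w : 'rV[R]_n) : tangent (ch_inv c x) :=
  'd (ch_map (chart_at M (ch_inv c x)) \o ch_inv c) x w.

Section Maps.
Variables (R : realType) (m n : nat) (M : manifold R m) (N : manifold R n).

Definition smooth_map (f : M -> N) : Prop :=
  continuous f /\
  forall c d, atlas M c -> atlas N d ->
    smooth_on (ch_cod c `&` (f \o ch_inv c) @^-1` ch_dom d)
              (ch_map d \o f \o ch_inv c).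

Definition mdiff (f : M -> N) (p : M) (v : tangent p) : tangent (f p) :=
  'd (ch_map (chart_at N (f p)) \o f \o ch_inv (chart_at M p)) (mcoord p) v.

Definition submersion (f : M -> N) : Prop :=
  smooth_map f /\
  forall p (u : tangent (f p)), exists v : tangent p, mdiff f v = u.

(* Smooth embeddings: injective immersions that are homeomorphisms onto their
   image. *)
Definition embedding (f : M -> N) : Prop :=
  [/\ smooth_map f, injective f,
      forall p, injective (@mdiff f p) &
      forall U : set M, open U ->
        exists2 W : set N, open W & f @` U = range f `&` W].

Definition vertical (f : M -> N) (p : M) : set (tangent p) :=
  [set w | mdiff f w = 0].

End Maps.

Section PseudoFinsler.
Variables (R : realType) (n : nat) (M : manifold R n).

(* A subset of TM is a family of subsets of the tangent spaces; a function on
   a subset of TM is extended arbitrarily to the whole of TM. *)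
Implicit Types (A : forall p : M, set (tangent p)) (L : forall p : M, tangent p -> R).

Definition in_chart A (c : chart R n M) : set ('rV[R]_n * 'rV[R]_n) :=
  [set z | ch_cod c z.1 /\ A (ch_inv c z.1) (tangent_of c z.1 z.2)].

Definition fundamental_tensor L (p : M) (v e h : tangent p) : R :=
  2^-1 * derive1 (fun s : R => derive1 (fun t : R => L p (v + s *: e + t *: h)) 0) 0.

Record pseudo_finsler A L : Prop := PseudoFinsler {
  adm_neq0 : forall p v, A p v -> v != 0;
  adm_cone : forall p v (a : R), 0 < a -> A p v -> A p (a *: v);
  adm_open : forall c, atlas M c -> open (in_chart A c);
  L_smooth : forall c, atlas M c ->
    smooth_on (in_chart A c)
      (fun z => L (ch_inv c z.1) (tangent_of c z.1 z.2) : R^o);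
  L_homog : forall p v (a : R), 0 < a -> A p v -> L p (a *: v) = a ^+ 2 * L p v;
  L_nondeg : forall p v, A p v ->
    forall e, (forall h, fundamental_tensor L v e h = 0) -> e = 0
}.

Definition legendre L (p : M) (v : tangent p) : tangent p -> R :=
  fundamental_tensor L v v.

Definition nonzero_covectors (p : M) : set (tangent p -> R) :=
  [set a | scalar a /\ exists w, a w != 0].

End PseudoFinsler.

Section Submersions.
Variables (R : realType) (m n : nat) (M : manifold R m) (B : manifold R n).

Definition horizontal (A : forall p : M, set (tangent p))
    (L : forall p : M, tangent p -> R) (sigma : M -> B) (p : M) :
    set (tangent p) :=
  [set v | A p v /\ forall w, vertical sigma w -> fundamental_tensor L v v w = 0].

(* In psub_fiber, (F, iota) ranges over the embedded submanifolds of M whose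
   underlying set is the fiber over b, and the restriction of L to TF is the
   pullback of L along iota.
   psub_nondeg is not a consequence of the other clauses, because these do not
   require any admissible vector to be vertical.  For instance let sigma be the
   projection of R^3 onto its first two coordinates and, in the components of
   tangent vectors, L (a, b, c) = a^2 + b c and L' (a, b) = a^2 + b^2, both
   restricted to a > 0: the horizontal vectors are the (a, 0, c). *)
Record pseudo_finsler_submersion
    (A : forall p : M, set (tangent p)) (L : forall p : M, tangent p -> R)
    (A' : forall b : B, set (tangent b)) (L' : forall b : B, tangent b -> R)
    (sigma : M -> B) : Prop := PseudoFinslerSubmersion {
  psub_total : pseudo_finsler A L;
  psub_base : pseudo_finsler A' L';
  psub_surj : forall b, exists p, sigma p = b;
  psub_subm : submersion sigma;
  psub_fiber : forall (b : B) (d : nat) (F : manifold R d) (iota : F -> M),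
    embedding iota -> range iota = sigma @^-1` [set b] ->
    pseudo_finsler (fun q w => A (iota q) (mdiff iota w))
                   (fun q w => L (iota q) (mdiff iota w));
  psub_isom : forall p (v : tangent p), horizontal A L sigma v ->
    A' (sigma p) (mdiff sigma v) /\ L p v = L' (sigma p) (mdiff sigma v);
  psub_nondeg : forall p (v : tangent p), horizontal A L sigma v ->
    forall e, vertical sigma e ->
      (forall w, vertical sigma w -> fundamental_tensor L v e w = 0) -> e = 0
}.

End Submersions.

(* Main.v *)
(** Everything happens in the single tangent space T_p M, with S = d sigma_p.
    The key identity is dL_v = dL~_(S v) o S for horizontal v.  Since ker S is
    g_v-nondegenerate, the inverse function theorem applied to
    x |-> (S x, dL_x restricted to ker S) provides, over every u close to S v, a
    horizontal x with |x - v| = O(|u - S v|); comparing the first order expansions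
    of L x = L~ u gives the identity, because dL_v kills ker S.  The Legendre
    transform of a horizontal vector is thus determined by its image, whence
    uniqueness.

    For existence let q c be the image of the horizontal vector with Legendre
    transform c o S, for c <> 0.  The range Q of q is open by the above, and closed
    in the complement of 0 because q is continuous and positively homogeneous and
    the unit sphere is compact.  If u <> 0 were not in Q, every segment from Q to u
    would pass through 0, so that q u and q (- u) would both lie on the ray
    opposite to u; then dL~ would take positively proportional values at them,
    whereas these values are u and - u. *)

From HB Require Import structures.
Require Import Defs.
From mathcomp Require Import all_boot all_order all_algebra.
From mathcomp Require Import all_classical all_reals all_analysis.
From mathcomp Require Import ring lra.

Set Implicit Arguments.
Unset Strict Implicit.
Unset Printing Implicit Defensive.

Import Order.TTheory GRing.Theory Num.Theory.
Import numFieldNormedType.Exports.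

Local Open Scope classical_set_scope.
Local Open Scope ring_scope.

(** Completeness of row vectors, on which the Banach fixed point theorem below relies. *)
HB.instance Definition _ (R : realType) (m n : nat) :=
  Uniform_isComplete.Build 'M[R]_(m, n) cauchy_cvg.

(** * The sup norm on row vectors *)

Section RowNorm.
Variable R : realType.

Lemma row_entry_le n (x : 'rV[R]_n) (i : 'I_n) : `|x 0 i| <= `|x|.
Proof.
rewrite [leRHS]/Num.Def.normr /= mx_normrE.
exact: (le_bigmax _ (fun ij : 'I_1 * 'I_n => `|x ij.1 ij.2|) (0, i)).
Qed.

Lemma row_norm_le n (x : 'rV[R]_n) (e : R) :
  0 <= e -> (forall i, `|x 0 i| <= e) -> `|x| <= e.
Proof.
move=> e0 xe; rewrite /Num.Def.normr /= mx_normrE; apply: bigmax_le => // -[j i] _ /=.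
by rewrite ord1.
Qed.

Lemma mulmx_bounded n m (T : 'M[R]_(n, m)) :
  exists2 C, 0 < C & forall x : 'rV[R]_n, `|x *m T| <= C * `|x|.
Proof.
exists (\sum_(i < n) \sum_(j < m) `|T i j| + 1).
  by apply: ltr_wpDl => //; apply: sumr_ge0 => i _; apply: sumr_ge0.
move=> x; apply: row_norm_le => [|j].
  by rewrite mulr_ge0// addr_ge0//; apply: sumr_ge0 => i _; apply: sumr_ge0.
rewrite mxE (le_trans (ler_norm_sum _ _ _))//.
rewrite mulrDl mul1r ler_wpDr//.
rewrite mulr_suml; apply: ler_sum => i _; rewrite normrM mulrC ler_pM//.
  by rewrite (bigD1 j)//= lerDl sumr_ge0.
exact: row_entry_le.
Qed.

End RowNorm.

(** * Mean value theorem and first order expansion *)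

Section Differentials.
Variables (R : realType) (V : normedModType R) (f : V -> R^o).

Lemma mean_value (x y : V) :
  (forall t : R, 0 <= t <= 1 -> differentiable f (y + t *: (x - y))) ->
  exists2 t : R, 0 <= t <= 1 & f x - f y = 'd f (y + t *: (x - y)) (x - y).
Proof.
move=> df; pose g (t : R) := f (y + t *: (x - y)) : R.
have dg (t : R) : 0 <= t <= 1 ->
    is_derive t 1 (g : R -> R^o) ('d f (y + t *: (x - y)) (x - y)).
  move=> /df dft.
  have h : is_diff t (fun t : R => y + t *: (x - y)) (fun s : R => s *: (x - y)).
    by apply: is_diff_eq; apply/funext => s /=; rewrite !fctE add0r.
  have dc : differentiable (f \o (fun t : R => y + t *: (x - y))) t.
    by apply: differentiable_comp.
  apply: DeriveDef; first exact: diff_derivable.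
  by rewrite deriveE // diff_comp //= diff_val scale1r.
have [||t] := @MVT_segment R g (fun t => 'd f (y + t *: (x - y)) (x - y)) 0 1 ler01.
- by move=> t; rewrite in_itv /= => /andP[/ltW t0 /ltW t1]; apply: dg; rewrite t0.
- apply: derivable_within_continuous => t; rewrite in_itv /= => /dg dgt.
  exact: ex_derive.
rewrite in_itv /= => t01; rewrite subr0 mulr1 /g scale1r scale0r addr0 subrKC => ->.
by exists t.
Qed.

Lemma diff_approx (x : V) (e : R) : differentiable f x -> 0 < e ->
  exists2 r : R, 0 < r & forall h, `|h| < r ->
    `|f (x + h) - f x - 'd f x h| <= e * `|h|.
Proof.
move=> /diff_locally /eqaddoP/(_ e) H e0; have /nbhs_normP[r /= r0 Hr] := H e0.
exists r => // h hr; have := Hr h; rewrite /ball_ /= sub0r normrN => /(_ hr).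
by rewrite !fctE /= [h + x]addrC opprD addrA.
Qed.

End Differentials.

(** * A quantitative inverse function theorem *)

Section InverseFunction.
Variables (R : realType) (m : nat).
Implicit Types x y a w : 'rV[R]_m.

Lemma diff_row_sum (f : 'rV[R]_m -> R^o) x w : differentiable f x ->
  'd f x w = \sum_(j < m) w 0 j * 'D_('e_j) f x.
Proof.
move=> df; rewrite [w in LHS]row_sum_delta linear_sum; apply: eq_bigr => j _.
by rewrite linearZ deriveE.
Qed.

(** Balls are convex, so the mean value theorem applies on the segment from [y] to [x]; the factor
    [m] counts the partial derivatives, each entry of [x - y] being at most its norm. *)
Lemma lipschitz_of_partials (f : 'rV[R]_m -> R^o) a (r e : R) x y :
  (forall z, `|z - a| <= r -> differentiable f z) ->
  (forall z j, `|z - a| <= r -> `|'D_('e_j) f z| <= e) ->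
  `|x - a| <= r -> `|y - a| <= r -> `|f x - f y| <= m%:R * e * `|x - y|.
Proof.
move=> df De xr yr.
have seg (t : R) : 0 <= t <= 1 -> `|y + t *: (x - y) - a| <= r.
  move=> /andP[t0 t1].
  have -> : y + t *: (x - y) - a = (1 - t) *: (y - a) + t *: (x - a).
    by apply/rowP => i; rewrite !mxE; ring.
  rewrite (le_trans (ler_normD _ _))// !normrZ !ger0_norm ?subr_ge0//.
  have : (1 - t) * `|y - a| <= (1 - t) * r by rewrite ler_wpM2l ?subr_ge0.
  have : t * `|x - a| <= t * r by rewrite ler_wpM2l.
  lra.
have [t /seg tr ->] := @mean_value _ _ f x y (fun t ht => df _ (seg t ht)).
rewrite diff_row_sum; last exact: df.
rewrite (le_trans (ler_norm_sum _ _ _))//.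
apply: (@le_trans _ _ (\sum_(j < m) e * `|x - y|)).
  apply: ler_sum => j _; rewrite normrM mulrC ler_pM// ?row_entry_le//.
  exact: De.
by rewrite sumr_const card_ord -mulrA mulr_natl.
Qed.

(** Solutions of [G x = y] are the fixed points of [phi x = x - G x + y], whose differential
    vanishes at [a] and which is therefore a contraction near [a]. *)
Lemma inverse_function_id (G : 'rV[R]_m -> 'rV[R]_m) (U : set 'rV[R]_m) a :
  open U -> U a ->
  (forall i x, U x -> differentiable (fun x => G x 0 i : R^o) x) ->
  (forall i w, {for a, continuous ('D_w (fun x => G x 0 i : R^o))}) ->
  (forall i w, 'D_w (fun x => G x 0 i : R^o) a = w 0 i) ->
  exists2 r, 0 < r & forall y, `|y - G a| < r ->
    exists x, [/\ U x, G x = y & `|x - a| <= 2 * `|y - G a| ].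
Proof.
move=> oU Ua dG cG DG.
pose h i x : R^o := x 0 i - G x 0 i.
have dh i x : U x -> differentiable (h i) x.
  by move=> Ux; apply: differentiableB; [exact: differentiable_coord|exact: dG].
have Dh i j x : U x -> 'D_('e_j) (h i) x = (i == j)%:R - 'D_('e_j) (fun x => G x 0 i : R^o) x.
  move=> Ux; have dc := @differentiable_coord R _ _ x 0 i.
  rewrite deriveB; [|exact: diff_derivable|by apply: diff_derivable; exact: dG].
  congr (_ - _); rewrite /derive.
  apply: lim_near_cst => //; near=> t.
  rewrite /= !mxE /= addrK [LHS]mulrA mulVf ?mul1r ?eqxx ?[_ == i]eq_sym//.
  by near: t; exact: nbhs_dnbhs_neq.
(* Chosen so that [m%:R * e <= 2^-1], the contraction factor; [m + 1] guards against [m = 0]. *)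
pose e : R := (2 * (m%:R + 1))^-1.
have e0 : 0 < e by rewrite invr_gt0 mulr_gt0// ltr_wpDl.
have [r r0 Hr] : exists2 r, 0 < r & forall x, `|x - a| <= r ->
    U x /\ forall i j, `|'D_('e_j) (h i) x| <= e.
  have : \forall x \near a, U x /\ forall i j, `|'D_('e_j) (h i) x| <= e.
    suff H : \forall x \near a, forall i j, `|'D_('e_j) (h i) x| <= e.
      by near=> x; split; near: x => //; exact: open_nbhs_nbhs.
    near=> x; near: x; apply: filter_forall => i; apply: filter_forall => j.
    have /cvgrPdist_lt/(_ e e0) Hc := cG i 'e_j.
    near=> x; rewrite Dh; last by near: x; exact: open_nbhs_nbhs.
    have : `|'D_('e_j) (fun x => G x 0 i : R^o) a - 'D_('e_j) (fun x => G x 0 i : R^o) x| < e.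
      by near: x.
    by rewrite DG mxE eqxx /= => /ltW.
  move=> /nbhs_normP[r /= r0 Hr]; exists (r / 2); first by rewrite divr_gt0.
  move=> x xr; apply: Hr; rewrite /ball_ /= distrC (le_lt_trans xr)//.
  by rewrite ltr_pdivrMr// ltr_pMr// ltr1n.
have me : m%:R * e <= 2^-1.
  have m1 : 0 < m%:R + 1 :> R by rewrite ltr_wpDl.
  rewrite /e invfM mulrCA ler_piMr ?invr_ge0//.
  by rewrite ler_pdivrMr// mul1r lerDl.
exists (r / 2); first by rewrite divr_gt0.
move=> y yr; set d := `|y - G a|; have d0 : 0 <= d by exact: normr_ge0.
(* [phi] moves the centre [a] by [d] and at least halves distances, hence maps the ball of radius
   [2 * d] to itself. This radius is also the final estimate. *)
pose U' := closed_ball_ (Num.norm : 'rV[R]_m -> R) a (2 * d).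
have dr : 2 * d <= r by rewrite mulrC -ler_pdivlMr// ltW.
have U'r x : U' x -> `|x - a| <= r.
  by rewrite /U' /closed_ball_ /= distrC => /le_trans; apply.
pose phi x := x - G x + y.
have phiL x x' : U' x -> U' x' -> `|phi x - phi x'| <= 2^-1 * `|x - x'|.
  move=> Ux Ux'; apply: row_norm_le => [|i]; first by rewrite mulr_ge0.
  have -> : (phi x - phi x') 0 i = h i x - h i x'.
    by rewrite !mxE /h; ring.
  apply: le_trans (_ : _ <= m%:R * e * `|x - x'|) _.
    apply: (@lipschitz_of_partials _ a r) => //; try exact: U'r.
    - by move=> z /Hr[Uz _]; exact: dh.
    - by move=> z j /Hr[_].
  by rewrite ler_wpM2r.
have phi_fun : set_fun U' U' phi.
  move=> x Ux; rewrite /U' /closed_ball_ /= distrC.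
  have Ua' : U' a by rewrite /U' /closed_ball_ /= subrr normr0 mulr_ge0.
  have -> : phi x - a = (phi x - phi a) + (y - G a).
    by apply/rowP => i; rewrite /phi !mxE; ring.
  rewrite (le_trans (ler_normD _ _))//.
  have := phiL _ _ Ux Ua'; move: Ux.
  rewrite /U' /closed_ball_ /= distrC -/d; lra.
pose phiF : {fun U' >-> U'} := HB.pack phi (isFun.Build _ _ _ _ _ phi_fun).
have [||x Ux xE] := @banach_fixed_point R _ U' phiF _ (@closed_closed_ball_ _ _ _ _).
- have q0 : (0 : R) <= 2^-1 by [].
  exists (NngNum q0); split => /=; first by rewrite invf_lt1// ltr1n.
  by move=> [x x'] [/= Ux Ux']; exact: phiL.
- by exists a; rewrite /U' /closed_ball_ /= subrr normr0 mulr_ge0.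
exists x; split; first by have [] := Hr x (U'r _ Ux).
- move: xE; rewrite /= /phi -[in LHS](addr0 x) -addrA => /addrI /esym/eqP.
  by rewrite addrC subr_eq0 => /eqP.
- by move: Ux; rewrite /U' /closed_ball_ /= distrC.
Unshelve. all: by end_near. Qed.

(** Composing [F] with the inverse of its Jacobian at [a] reduces to a map whose differential there
    is the identity. *)
Lemma inverse_function (F : 'rV[R]_m -> 'rV[R]_m) (U : set 'rV[R]_m) a :
  open U -> U a ->
  (forall i x, U x -> differentiable (fun x => F x 0 i : R^o) x) ->
  (forall i w, {for a, continuous ('D_w (fun x => F x 0 i : R^o))}) ->
  (forall w, (forall i, 'D_w (fun x => F x 0 i : R^o) a = 0) -> w = 0) ->
  exists C r, [/\ 0 < C, 0 < r & forall y, `|y - F a| < r ->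
    exists x, [/\ U x, F x = y & `|x - a| <= C * `|y - F a| ]].
Proof.
move=> oU Ua dF cF injF.
pose J := \matrix_(j < m, i < m) 'D_('e_j) (fun x => F x 0 i : R^o) a.
have JE w i : 'D_w (fun x => F x 0 i : R^o) a = (w *m J) 0 i.
  rewrite deriveE; last exact: dF.
  rewrite diff_row_sum; last exact: dF.
  by rewrite mxE; apply: eq_bigr => j _; rewrite mxE.
have uJ : J \in unitmx.
  rewrite -row_free_unit -kermx_eq0; apply/eqP/row_matrixP => i; rewrite row0.
  apply: injF => j; rewrite JE.
  by rewrite (_ : row i (kermx J) *m J = 0) ?mxE// -row_mul mulmx_ker row0.
pose T := invmx J; pose G x := F x *m T.
have GE i : (fun x => G x 0 i : R^o) = \sum_(k < m) (T k i \*: (fun x => F x 0 k : R^o)).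
  apply/funext => x; rewrite /G mxE fct_sumE; apply: eq_bigr => k _ /=.
  by rewrite [RHS]mulrC.
have dG i x : U x -> differentiable (fun x => G x 0 i : R^o) x.
  by move=> Ux; rewrite GE; apply: differentiable_sum => k; apply: differentiableZ; exact: dF.
have DG i w x : U x ->
    'D_w (fun x => G x 0 i : R^o) x = \sum_(k < m) (T k i * 'D_w (fun x => F x 0 k : R^o) x).
  move=> Ux; have dk k : derivable (fun x => F x 0 k : R^o) x w.
    by apply: diff_derivable; exact: dF.
  rewrite GE derive_sum => [|k]; last exact: derivableZ.
  by apply: eq_bigr => k _; rewrite deriveZ.
have [||r r0 Hr] := @inverse_function_id G U a oU Ua dG.
- move=> i w; rewrite /continuous_at.
  have cc : (fun x => \sum_(k < m) (T k i * 'D_w (fun x => F x 0 k : R^o) x)) x @[x --> a]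
     --> 'D_w (fun x => G x 0 i : R^o) a.
    rewrite DG//; apply: (@cvg_big R _ _ _ _ (@add_continuous R) _ (nbhs a)) => k _.
    apply: cvgM; first exact: cvg_cst.
    exact: cF.
  apply: (cvg_trans _ cc); apply: (@near_eq_cvg _ _ (nbhs a)); near=> x.
  by rewrite DG//; near: x; exact: open_nbhs_nbhs.
- move=> i w; rewrite DG//; under eq_bigr do rewrite JE mulrC.
  have <- : (w *m J *m T) 0 i = \sum_(k < m) (w *m J) 0 k * T k i by rewrite mxE.
  by rewrite -mulmxA mulmxV// mulmx1.
have [C C0 HC] := mulmx_bounded T.
exists (2 * C), (r / C); split; [by rewrite mulr_gt0|by rewrite divr_gt0|].
move=> y yr.
have yC : `|y *m T - G a| <= C * `|y - F a| by rewrite /G -mulmxBl.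
have [|x [Ux Gx xa]] := Hr (y *m T).
  by rewrite (le_lt_trans yC)// mulrC -ltr_pdivlMr.
exists x; split => //.
  by have /(congr1 (mulmx^~ J)) := Gx; rewrite /G -!mulmxA mulVmx// !mulmx1.
by rewrite (le_trans xa)// -mulrA ler_wpM2l.
Unshelve. all: by end_near. Qed.

End InverseFunction.

(** * Pseudo-Finsler metrics on a single tangent space *)

Section PseudoNorms.
Variables (R : realType) (m : nat).

(** The restriction of a pseudo-Finsler metric to one tangent space, with regularity of order two;
    [pn_nondeg] uses the Hessian, which is twice the fundamental tensor. *)
Record pseudo_norm (A : set 'rV[R]_m) (l : 'rV[R]_m -> R^o) : Prop := PseudoNorm {
  pn_open : open A;
  pn_neq0 : forall v, A v -> v != 0;
  pn_cone : forall v (a : R), 0 < a -> A v -> A (a *: v);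
  pn_diff : forall v, A v -> differentiable l v;
  pn_diff2 : forall w v, A v -> differentiable ('D_w l) v;
  pn_cont2 : forall e w v, A v -> {for v, continuous ('D_e ('D_w l))};
  pn_homog : forall v (a : R), 0 < a -> A v -> l (a *: v) = a ^+ 2 * l v;
  pn_nondeg : forall v, A v ->
    forall e, (forall h, 'D_e ('D_h l) v = 0) -> e = 0
}.

Variables (A : set 'rV[R]_m) (l : 'rV[R]_m -> R^o).
Hypothesis hl : pseudo_norm A l.

Lemma derive_comb v k (c : 'I_k -> R) (h : 'I_k -> 'rV[R]_m) : A v ->
  'D_(\sum_i c i *: h i) l v = \sum_i c i * 'D_(h i) l v.
Proof.
move=> Av; have dl := pn_diff hl Av.
rewrite deriveE// linear_sum; apply: eq_bigr => i _.
by rewrite linearZ deriveE.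
Qed.

Lemma derive2_comb v w k (c : 'I_k -> R) (h : 'I_k -> 'rV[R]_m) : A v ->
  'D_w ('D_(\sum_i c i *: h i) l) v = \sum_i c i * 'D_w ('D_(h i) l) v.
Proof.
move=> Av.
rewrite (@near_eq_derive _ _ _ _ (\sum_i (c i \*: ('D_(h i) l : _ -> R^o)))).
  rewrite derive_sum => [|i]; last first.
    by apply: derivableZ; apply: diff_derivable; exact: (pn_diff2 hl).
  apply: eq_bigr => i _; rewrite deriveZ//.
  by apply: diff_derivable; exact: (pn_diff2 hl).
near=> x; rewrite fct_sumE derive_comb//.
by near: x; exact: open_nbhs_nbhs (conj (pn_open hl) Av).
Unshelve. all: by end_near. Qed.

(** Differentiate [l (a *: x) = a ^+ 2 * l x] at [v] in the direction [h] and cancel one factor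
    [a]. *)
Lemma derive_scale v h (a : R) : 0 < a -> A v -> 'D_h l (a *: v) = a * 'D_h l v.
Proof.
move=> a0 Av; have Aav := pn_cone hl a0 Av.
have da : is_diff v (fun x : 'rV[R]_m => a *: x) (fun x => a *: x) by exact: is_diff_scaler.
apply: (@mulfI _ a); first by rewrite gt_eqF.
transitivity ('D_h (l \o (fun x => a *: x)) v).
  have dla := pn_diff hl Aav.
  rewrite [RHS]deriveE; last by apply: differentiable_comp => //; exact: ex_diff.
  by rewrite diff_comp//= diff_val linearZ deriveE.
rewrite (@near_eq_derive _ _ _ _ (a ^+ 2 \*: l)).
  by rewrite deriveZ//; [rewrite [RHS]mulrA -expr2|exact/diff_derivable/(pn_diff hl)].
near=> x => /=; apply: (pn_homog hl) => //.
by near: x; exact: open_nbhs_nbhs (conj (pn_open hl) Av).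
Unshelve. all: by end_near. Qed.

(** Euler's relation for ['D_h l], which is positively homogeneous of degree 1. It identifies the
    Legendre transform of [v] with half the differential of [l] at [v]. *)
Lemma derive_euler v h : A v -> 'D_v ('D_h l) v = 'D_h l v.
Proof.
move=> Av; rewrite {1}/derive; apply: lim_near_cst => //; near=> t.
(* Ensures [0 < t + 1], as homogeneity demands. *)
have t1 : `|t| < 1.
  by near: t; apply: dnbhs0_lt.
have -> : (('D_h l) \o shift v) (t *: v) = 'D_h l ((t + 1) *: v).
  by rewrite /= scalerDl scale1r.
rewrite derive_scale//; last first.
  by move: t1; rewrite ltr_norml => /andP[]; lra.
rewrite mulrDl mul1r addrK [LHS]mulrA mulVf ?mul1r//.
by near: t; exact: nbhs_dnbhs_neq.
Unshelve. all: by end_near. Qed.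

(** If the differential vanished, Euler's relation would put [v] in the kernel of the Hessian, so
    [v] would be 0, which is not admissible. *)
Lemma derive_neq0 v : A v -> exists w, 'D_w l v != 0.
Proof.
move=> Av; apply: contrapT => /forallNP H.
have /eqP := pn_neq0 hl Av; apply; apply: (pn_nondeg hl Av) => h.
by rewrite derive_euler//; apply/eqP; have /negP := H h; rewrite negbK.
Qed.

(** On [A] this is twice the Legendre map in coordinates, by [derive_euler]. *)
Definition differential_row v : 'rV[R]_m := \row_i 'D_('e_i) l v.

Lemma differential_rowE v w : A v -> 'D_w l v = (w *m (differential_row v)^T) 0 0.
Proof.
move=> Av; rewrite [w in LHS]row_sum_delta derive_comb// mxE.
by apply: eq_bigr => i _; rewrite !mxE.
Qed.

(** The Jacobian of [differential_row] at [v] is the Hessian of [l], invertible by [pn_nondeg]. *)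
Lemma differential_row_local_inverse v : A v ->
  exists C r, [/\ 0 < C, 0 < r & forall b, `|b - differential_row v| < r ->
    exists x, [/\ A x, differential_row x = b &
                  `|x - v| <= C * `|b - differential_row v| ]].
Proof.
move=> Av.
have FE i : (fun x => differential_row x 0 i : R^o) = 'D_('e_i) l.
  by apply/funext => x; rewrite mxE.
apply: (@inverse_function _ _ _ A) => //; first exact: pn_open hl.
- by move=> i x Ax; rewrite FE; exact: pn_diff2 hl _ _ Ax.
- by move=> i w; rewrite FE; exact: pn_cont2 hl _ _ _ Av.
- move=> w Dw; apply: (pn_nondeg hl Av) => h.
  rewrite [h]row_sum_delta derive2_comb//; apply: big1 => i _.
  by rewrite -FE Dw mulr0.
Qed.

End PseudoNorms.

(** * Coordinates adapted to the kernel of a matrix *)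

Section KernelCoordinates.
Variables (F : fieldType) (m n : nat) (S : 'M[F]_(m, n)).

(** [S] factors as [col_ebase S], a truncation to the first [\rank S] entries, and the invertible
    [row_ebase S]. *)
Lemma kernel_coords (h : 'rV[F]_m) :
  h *m S = 0 <-> forall i : 'I_m, (i < \rank S)%N -> (h *m col_ebase S) 0 i = 0.
Proof.
have pidE (z : 'rV[F]_m) i : (z *m (pid_mx (\rank S) : 'M[F]_m)) 0 i = z 0 i * (i < \rank S)%N%:R.
  rewrite mxE (bigD1 i)//= big1 ?addr0 => [|j ji].
    by rewrite !mxE eqxx.
  by rewrite !mxE -[_ == _ :> nat]/(j == i) (negbTE ji) mulr0.
have rn := rank_leq_col S.
have rm := rank_leq_row S.
split=> [hS i ir|hi].
  have : h *m col_ebase S *m (pid_mx (\rank S) : 'M[F]_m) = 0.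
    transitivity (h *m S *m invmx (row_ebase S) *m (pid_mx (\rank S) : 'M[F]_(n, m))).
      rewrite -[X in _ = h *m X *m _ *m _]mulmx_ebase !mulmxA mulmxK ?row_ebase_unit//.
      by rewrite -[RHS]mulmxA mul_pid_mx minnn (minn_idPr rn).
    by rewrite hS !mul0mx.
  by move/rowP/(_ i); rewrite pidE ir mulr1 => ->; rewrite mxE.
have pE : (pid_mx (\rank S) : 'M[F]_(m, n)) = (pid_mx (\rank S) : 'M[F]_m) *m pid_mx (\rank S).
  by rewrite mul_pid_mx minnn (minn_idPr rm).
rewrite -[S in LHS]mulmx_ebase pE !mulmxA.
have -> : h *m col_ebase S *m (pid_mx (\rank S) : 'M[F]_m) = 0; last by rewrite !mul0mx.
apply/rowP => i; rewrite pidE [RHS]mxE.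
by case: (ltnP i (\rank S)) => [/hi ->|]; rewrite ?mul0r ?mulr0.
Qed.

End KernelCoordinates.

(** * Derivatives of linear functions *)

Section LinearFunctions.
Variables (R : realType) (V W : normedModType R) (f : V -> W).
Hypothesis flin : forall (t : R) v x, f (t *: v + x) = t *: f v + f x.

Lemma derive_linear v x : 'D_v f x = f v.
Proof.
rewrite /derive; apply: lim_near_cst => //; near=> t.
rewrite /= flin addrK scalerA mulVf ?scale1r//.
by near: t; exact: nbhs_dnbhs_neq.
Unshelve. all: by end_near. Qed.

End LinearFunctions.

Lemma differentiable_mulmx_coord (R : realType) m n (C : 'M[R]_(m, n)) i x :
  differentiable (fun x : 'rV[R]_m => (x *m C) 0 i : R^o) x.
Proof.
have -> : (fun x : 'rV[R]_m => (x *m C) 0 i : R^o) =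
    \sum_(k < m) (C k i \*: (fun x : 'rV[R]_m => x 0 k : R^o)).
  apply/funext => z; rewrite mxE fct_sumE; apply: eq_bigr => k _ /=.
  by rewrite [RHS]mulrC.
apply: differentiable_sum => k; apply: differentiableZ.
exact: differentiable_coord.
Qed.

Lemma near_neq0 (R : realType) (V : normedModType R) (u : V) :
  u != 0 -> \forall x \near u, x != 0.
Proof.
move=> u0; apply/nbhs_normP; exists `|u|; first by rewrite /= normr_gt0.
by move=> x /=; apply: contraTneq => ->; rewrite subr0 ltxx.
Qed.

(** * Horizontal vectors of a linear submersion *)

Section LinearSubmersion.
Variables (R : realType) (m n : nat).
Variables (A : set 'rV[R]_m) (l : 'rV[R]_m -> R^o).
Variables (A' : set 'rV[R]_n) (l' : 'rV[R]_n -> R^o).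
Variable S : 'M[R]_(m, n).

(** Horizontality phrased with the differential: by Euler's relation ['D_h l x] is twice the
    [g_x]-product of [x] and [h]. *)
Definition horizontal_row : set 'rV[R]_m :=
  [set x | A x /\ forall h, h *m S = 0 -> 'D_h l x = 0].

Hypotheses (hl : pseudo_norm A l) (hl' : pseudo_norm A' l').
Hypothesis Sfull : row_full S.
Hypothesis Siso : forall x, horizontal_row x -> A' (x *m S) /\ l x = l' (x *m S).
Hypothesis Snondeg : forall x, horizontal_row x -> forall e, e *m S = 0 ->
  (forall w, w *m S = 0 -> 'D_e ('D_w l) x = 0) -> e = 0.

(** A vector killed by the differential of [F] at [a] lies in the kernel of [S] and is
    [g_a]-orthogonal to that kernel, hence is zero by [Snondeg]. So the inverse function theorem
    applies to [F]. *)
Lemma horizontal_lift a : horizontal_row a ->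
  exists C r, [/\ 0 < C, 0 < r & forall u, `|u - a *m S| < r ->
    exists x, [/\ horizontal_row x, x *m S = u & `|x - a| <= C * `|u - a *m S| ]].
Proof.
move=> Ha; have [Aa va] := Ha.
pose E := col_ebase S; pose E' := invmx E.
have uE : E \in unitmx by exact: col_ebase_unit.
pose r := \rank S.
(* In the coordinates x *m E the kernel of S is the vanishing of the first r
   entries, and the rows i >= r of E' form a basis of it. *)
pose F x : 'rV[R]_m := \row_i if (i < r)%N then (x *m E) 0 i else 'D_(row i E') l x.
have Flt (i : 'I_m) : (i < r)%N -> (fun x => F x 0 i : R^o) = fun x => (x *m E) 0 i.
  by move=> ir; apply/funext => x; rewrite mxE ir.
have Fge (i : 'I_m) : (i < r)%N = false -> (fun x => F x 0 i : R^o) = 'D_(row i E') l.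
  by move=> ir; apply/funext => x; rewrite mxE ir.
have Flin (i : 'I_m) w x : 'D_w (fun x : 'rV[R]_m => (x *m E) 0 i : R^o) x = (w *m E) 0 i.
  by apply: derive_linear => t v y; rewrite mulmxDl -scalemxAl !mxE.
have vertE (i : 'I_m) : (i < r)%N = false -> row i E' *m S = 0.
  move=> ir; apply/kernel_coords => j jr; rewrite -row_mul mulVmx// !mxE.
  by case: eqP => // ij; rewrite ij jr in ir.
have vert_sum h : h *m S = 0 ->
    h = \sum_(i < m) (if (i < r)%N then 0 else (h *m E) 0 i) *: row i E'.
  move=> hS; rewrite -[LHS](mulmxK uE) mulmx_sum_row; apply: eq_bigr => i _.
  by case: ifP => // ir; have /kernel_coords/(_ i ir) -> := hS.
have [|||C [r0 [C0 r00 HF]]] := @inverse_function _ _ F A a (pn_open hl) Aa.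
- move=> i x Ax; case: (boolP (i < r)%N) => [ir|/negbTE ir].
    by rewrite Flt//; exact: differentiable_mulmx_coord.
  by rewrite Fge//; exact: (pn_diff2 hl).
- move=> i w; case: (boolP (i < r)%N) => [ir|/negbTE ir].
    rewrite Flt// (_ : 'D_w _ = cst ((w *m E) 0 i)); last by apply/funext => x; rewrite Flin.
    exact: (@cst_continuous _ _ ((w *m E) 0 i) a).
  by rewrite Fge//; exact: (pn_cont2 hl).
- move=> w Dw; apply: (Snondeg Ha).
    apply/kernel_coords => i ir.
    by have := Dw i; rewrite Flt// Flin.
  move=> h /vert_sum ->; rewrite (derive2_comb hl)//; apply: big1 => i _.
  by case: ifP => ir; rewrite ?mul0r// -Fge// Dw mulr0.
pose T := pinvmx S.
have TS (u : 'rV[R]_n) : u *m T *m S = u by rewrite -mulmxA mulVpmx ?mulmx1.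
have [K K0 HK] := mulmx_bounded (T *m E).
exists (C * K), (r0 / K); split; [by rewrite mulr_gt0|by rewrite divr_gt0|].
(* [z] is a preimage of [u] near [a], and [y] prescribes its image together with vanishing
   derivatives along the kernel. As [a] is horizontal, the entries of [F a] from [r] on vanish too,
   so [u - a *m S] controls [y - F a]. *)
move=> u ur; pose z := a + (u - a *m S) *m T.
pose y : 'rV[R]_m := \row_i if (i < r)%N then (z *m E) 0 i else 0.
have yE i : y 0 i = if (i < r)%N then (z *m E) 0 i else 0 by rewrite mxE.
have FE x i : F x 0 i = if (i < r)%N then (x *m E) 0 i else 'D_(row i E') l x.
  by rewrite mxE.
have subE (v w : 'rV[R]_m) i : (v - w) 0 i = v 0 i - w 0 i.
  by rewrite mxE [X in _ + X]mxE.
have yF : `|y - F a| <= K * `|u - a *m S|.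
  apply: row_norm_le => [|i]; first by rewrite mulr_ge0// ltW.
  have -> : (y - F a) 0 i = if (i < r)%N then ((u - a *m S) *m (T *m E)) 0 i else 0.
    rewrite subE yE FE; case: ifP => ir; last by rewrite va ?vertE// subrr.
    by rewrite -subE /z -mulmxBl addrAC subrr add0r -mulmxA.
  case: ifP => _; first by rewrite (le_trans _ (HK _))// row_entry_le.
  by rewrite normr0 mulr_ge0// ltW.
have [|x [Ax Fx xa]] := HF y.
  by rewrite (le_lt_trans yF)// mulrC -ltr_pdivlMr.
exists x; split.
- split=> // h /vert_sum ->; rewrite (derive_comb hl)//; apply: big1 => i _.
  case: ifP => ir; rewrite ?mul0r//.
  by have := FE x i; rewrite ir => <-; rewrite Fx yE ir mulr0.
- have : (x - z) *m S = 0.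
    apply/kernel_coords => i ir; rewrite mulmxBl subE.
    by have /rowP/(_ i) := Fx; rewrite yE FE ir => ->; rewrite subrr.
  move/eqP; rewrite mulmxBl subr_eq0 => /eqP ->.
  by rewrite /z mulmxDl TS subrKC.
- by rewrite (le_trans xa)// -mulrA ler_wpM2l// ltW.
Qed.

(** For small [t], lift [a *m S + t *: (w *m S)] to a horizontal [x]. Then [l x - l a] expands both
    through ['d l a] and through the differential of [l']; dividing by [t] bounds the difference of
    the two differentials by any [e]. *)
Lemma derive_horizontal a w : horizontal_row a -> 'D_w l a = 'D_(w *m S) l' (a *m S).
Proof.
move=> Ha; have [Aa va] := Ha; have [Aa' la] := Siso Ha.
have dl := pn_diff hl Aa; have dl' := pn_diff hl' Aa'.
have [C [r [C0 r0 Hr]]] := horizontal_lift Ha.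
rewrite !deriveE//.
apply/eqP; rewrite -subr_eq0 -normr_le0; apply/ler_addgt0Pr => e e0; rewrite add0r.
set q := `|w *m S|; have q0 : 0 <= q by exact: normr_ge0.
(* [C * q] and [q] bound the increments of the two expansions divided by [t]; [K + 1] serves as a
   nonzero denominator. *)
pose K := C * q + q; have K0 : 0 <= K by rewrite addr_ge0// mulr_ge0// ltW.
have K1 : 0 < K + 1 by rewrite ltr_wpDl.
pose e' := e / (K + 1); have e'0 : 0 < e' by rewrite divr_gt0.
have [r1 r10 H1] := diff_approx dl e'0.
have [r2 r20 H2] := diff_approx dl' e'0.
pose rho := Num.min r (Num.min r1 r2).
have rho0 : 0 < rho by rewrite !lt_min r0 r10 r20.
pose t := rho / (K + 1); have t0 : 0 < t by rewrite divr_gt0.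
have small k : k <= K -> t * k < rho.
  move=> kK; rewrite /t mulrAC ltr_pdivrMr// ltr_pM2l//.
  by rewrite (le_lt_trans kK)// ltrDl.
have tq : `|t *: (w *m S)| = t * q by rewrite normrZ gtr0_norm.
have qK : q <= K by rewrite lerDr mulr_ge0// ltW.
have CqK : C * q <= K by rewrite lerDl.
have [|x [Hx xS xa]] := Hr (a *m S + t *: (w *m S)).
  rewrite addrAC subrr add0r tq (lt_le_trans (small _ qK))//.
  by rewrite /rho ge_min lexx.
rewrite addrAC subrr add0r tq in xa.
have xa' : `|x - a| <= t * (C * q) by rewrite mulrCA.
have lx := (Siso Hx).2; rewrite xS in lx.
(* [x - a - t *: w] lies in the kernel of [S], which the differential at the horizontal [a]
   annihilates. *)
have dxa : 'd l a (x - a) = t * 'd l a w.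
  apply/eqP; rewrite -subr_eq0 -[t * _]/(t *: _) -linearZ -linearB.
  by rewrite -deriveE// va// !mulmxBl xS -scalemxAl addrAC addrK subrr.
have h1 : `|l x - l a - t * 'd l a w| <= e' * (t * (C * q)).
  rewrite -dxa -[x in l x](subrKC a x) (le_trans (H1 _ _))//.
    by rewrite (le_lt_trans xa')// (lt_le_trans (small _ CqK))// /rho !ge_min lexx !orbT.
  by rewrite ler_wpM2l// ltW.
have h2 : `|l x - l a - t * 'd l' (a *m S) (w *m S)| <= e' * (t * q).
  have <- : 'd l' (a *m S) (t *: (w *m S)) = t * 'd l' (a *m S) (w *m S).
    by rewrite linearZ.
  rewrite la lx (le_trans (H2 _ _))//.
    by rewrite tq (lt_le_trans (small _ qK))// /rho !ge_min lexx !orbT.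
  by rewrite tq.
have : t * `|'d l a w - 'd l' (a *m S) (w *m S)| <= t * (e' * K).
  rewrite -{1}(gtr0_norm t0) -normrM.
  have -> : t * ('d l a w - 'd l' (a *m S) (w *m S)) =
      (l x - l a - t * 'd l' (a *m S) (w *m S)) - (l x - l a - t * 'd l a w) by ring.
  rewrite (le_trans (ler_normB _ _))//.
  have -> : t * (e' * K) = e' * (t * q) + e' * (t * (C * q)) by rewrite /K; ring.
  exact: lerD.
rewrite ler_pM2l// => /le_trans; apply.
rewrite /e' mulrAC ler_pdivrMr// ler_pM2l//.
by rewrite lerDl.
Qed.

Lemma horizontal_row_unique (x1 x2 : 'rV[R]_m) :
  (forall v1 v2, A v1 -> A v2 -> (forall w, 'D_w l v1 = 'D_w l v2) -> v1 = v2) ->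
  horizontal_row x1 -> horizontal_row x2 -> x1 *m S = x2 *m S -> x1 = x2.
Proof.
move=> inj H1 H2 E; apply: inj => [||w]; [by case: H1|by case: H2|].
by rewrite !derive_horizontal// E.
Qed.

Lemma horizontal_scale x (k : R) : 0 < k -> horizontal_row x -> horizontal_row (k *: x).
Proof.
move=> k0 [Ax vx]; split; first exact: (pn_cone hl).
by move=> h hS; rewrite (derive_scale hl)// vx// mulr0.
Qed.

(** * Existence of horizontal lifts when the Legendre map is bijective *)

Section Existence.
Hypothesis leg_inj : forall v1 v2, A v1 -> A v2 ->
  (forall w, 'D_w l v1 = 'D_w l v2) -> v1 = v2.
Hypothesis leg_surj : forall b : 'rV[R]_m, b != 0 -> exists2 v, A v &
  forall w, 'D_w l v = (w *m b^T) 0 0.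

(** The covector [c] composed with [S] is nonzero because [S] is onto, and it kills the kernel of
    [S], so the vector having it as differential is horizontal. *)
Lemma horizontal_section : exists v : 'rV[R]_n -> 'rV[R]_m,
  forall c, c != 0 -> horizontal_row (v c) /\
    forall w, 'D_w l (v c) = (w *m S *m c^T) 0 0.
Proof.
suff /choice[v Hv] : forall c : 'rV[R]_n, exists x, c != 0 -> horizontal_row x /\
    forall w, 'D_w l x = (w *m S *m c^T) 0 0 by exists v.
(* The value at [c = 0] is a dummy. *)
move=> c; have [->|c0] := eqVneq c 0; first by exists 0.
have [|x Ax Dx] := leg_surj (b := c *m S^T).
  apply: contra_neq c0 => /(congr1 trmx); rewrite trmx_mul trmxK trmx0 => cS.
    by apply: trmx_inj; rewrite -[LHS]mul1mx -(mulVpmx Sfull) -mulmxA cS mulmx0 trmx0.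
exists x => _; split => [|w]; last by rewrite Dx trmx_mul trmxK mulmxA.
by split=> // h hS; rewrite Dx trmx_mul trmxK mulmxA hS mul0mx mxE.
Qed.

Variable v : 'rV[R]_n -> 'rV[R]_m.
Hypothesis vP : forall c : 'rV[R]_n, c != 0 -> horizontal_row (v c) /\
  forall w, 'D_w l (v c) = (w *m S *m c^T) 0 0.

(** For nonzero [c] the differential of [l'] at [q c] is [c], by [derive_horizontal]: up to a factor
    2, [q] is a right inverse of the Legendre map of [l']. *)
Let q (c : 'rV[R]_n) := v c *m S.

Lemma section_neq0 (c : 'rV[R]_n) : c != 0 -> q c != 0.
Proof. by move=> /vP[/Siso[/(pn_neq0 hl')]]. Qed.

Lemma section_row (c : 'rV[R]_n) : c != 0 -> differential_row l (v c) = c *m S^T.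
Proof.
move=> c0; apply/rowP => i; rewrite mxE (vP c0).2 !mxE -rowE.
by apply: eq_bigr => j _; rewrite !mxE mulrC.
Qed.

(** By [leg_inj], near [c] the vector [v x] is the one that the local inverse of
    [differential_row l] assigns to [x *m S^T], and the linear estimate of that inverse gives
    continuity. *)
Lemma section_continuous (c : 'rV[R]_n) : c != 0 -> {for c, continuous q}.
Proof.
move=> c0; have [[Ac _] _] := vP c0.
have [C [r [C0 r0 Hr]]] := differential_row_local_inverse hl Ac.
have [K K0 HK] := mulmx_bounded S^T.
have [K' K'0 HK'] := mulmx_bounded S.
apply/(@cvgrPdist_lt _ _ _ (nbhs c)) => e e0.
suff : \forall t \near c, `|q c - q t| < e by [].
apply/nbhs_normP.
have CK0 : 0 < K' * (C * K) by rewrite !mulr_gt0.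
(* The three bounds keep [x] nonzero, bring its covector within reach of the local inverse, and make
   the final estimate smaller than [e]. *)
exists (Num.min `|c| (Num.min (r / K) (e / (K' * (C * K))))).
  by rewrite /= !lt_min normr_gt0 c0 !divr_gt0.
move=> x; rewrite /ball_ /= !lt_min => /and3P[xc xr xe].
have x0 : x != 0 by apply: contraTneq xc => ->; rewrite subr0 ltxx.
have bK : `|x *m S^T - differential_row l (v c)| <= K * `|c - x|.
  by rewrite section_row// -mulmxBl [in leRHS]distrC HK.
have [|y [Ay yx yc]] := Hr (x *m S^T).
  by rewrite (le_lt_trans bK)// mulrC -ltr_pdivlMr.
have vxy : v x = y.
  have [[Ax _] _] := vP x0; apply: leg_inj => // w.
  by rewrite !(differential_rowE hl)// yx section_row.
rewrite /q vxy -mulmxBl (le_lt_trans (HK' _))// distrC.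
rewrite (le_lt_trans (ler_wpM2l (ltW K'0) yc))//.
rewrite (le_lt_trans (ler_wpM2l (ltW K'0) (ler_wpM2l (ltW C0) bK)))//.
have -> : K' * (C * (K * `|c - x|)) = `|c - x| * (K' * (C * K)) by ring.
by rewrite -ltr_pdivlMr.
Qed.

Lemma section_scale (c : 'rV[R]_n) (k : R) : 0 < k -> c != 0 -> q (k *: c) = k *: q c.
Proof.
move=> k0 c0; have [Hc Dc] := vP c0.
have kc0 : k *: c != 0 by rewrite scaler_eq0 (gt_eqF k0).
have [[Akc _] Dkc] := vP kc0; rewrite /q scalemxAl; congr (_ *m _).
apply: leg_inj => [||w] //; first by have [] := horizontal_scale k0 Hc.
rewrite Dkc (derive_scale hl) ?Dc//; last by case: Hc.
by rewrite linearZ /= -scalemxAr mxE.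
Qed.

Definition horizontal_image : set 'rV[R]_n :=
  [set u | exists2 x, horizontal_row x & x *m S = u].

Local Notation Q := horizontal_image.

(** Given a horizontal [x], take for [c] the differential of [l'] at its image; [v c] and [x] then
    have the same differential. *)
Lemma horizontal_imageP u : Q u <-> exists2 c, c != 0 & q c = u.
Proof.
split=> [[x Hx <-]|[c c0 <-]]; last by exists (v c) => //; have [] := vP c0.
have [Ax _] := Hx; have [Aq _] := Siso Hx.
pose c := differential_row l' (x *m S).
have Dx w : 'D_w l x = (w *m S *m c^T) 0 0.
  by rewrite derive_horizontal// (differential_rowE hl').
have c0 : c != 0.
  apply: contraPneq (derive_neq0 hl Ax) => c0 [w].
  by rewrite Dx c0 trmx0 mulmx0 mxE eqxx.
exists c => //; congr (_ *m _); have [[Avc _] Dc] := vP c0.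
by apply: leg_inj => // w; rewrite Dc Dx.
Qed.

Lemma horizontal_image_neq0 u : Q u -> u != 0.
Proof. by move=> /horizontal_imageP[c /section_neq0 + <-]. Qed.

Lemma horizontal_image_scale u (k : R) : 0 < k -> Q u -> Q (k *: u).
Proof.
move=> k0 [x Hx <-]; exists (k *: x); first exact: horizontal_scale.
by rewrite scalemxAl.
Qed.

Lemma horizontal_image_open : open Q.
Proof.
rewrite openE => _ [a Ha <-]; have [C [r [_ r0 Hr]]] := horizontal_lift Ha.
suff : \forall u \near a *m S, Q u by [].
apply/nbhs_normP; exists r => // u; rewrite /ball_ /= distrC => /Hr.
by move=> [x [Hx xS _]]; exists x.
Qed.

(* Q is the positive cone over the compact image of the unit sphere under nml o q. *)
Lemma horizontal_image_closed : closed (Q `|` [set 0]).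
Proof.
pose nml (u : 'rV[R]_n) := `|u|^-1 *: u.
have nml_cont u : u != 0 -> {for u, continuous nml}.
  move=> u0; apply: continuousZ; last exact: (@cvg_id _ (nbhs u)).
  by apply: continuousV; [rewrite normr_eq0|exact: norm_continuous].
pose Sph : set 'rV[R]_n := [set c | `|c| = 1].
have Sph0 c : Sph c -> c != 0.
  by rewrite /Sph /= => c1; rewrite -normr_eq0 c1 oner_eq0.
have cSph : compact Sph.
  apply: bounded_closed_compact.
    by exists 1; split => // x x1 c /= ->; exact: ltW.
  rewrite (_ : Sph = Num.norm @^-1` [set 1])//.
  by apply: preimage_closed => [c _|]; [exact: norm_continuous|exact: closed_eq].
have cK : closed [set nml (q c) | c in Sph].
  apply: compact_closed; first exact: norm_hausdorff.
  apply: (@continuous_compact _ _ (nml \o q)) => //.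
  apply: continuous_in_subspaceT => c /[!inE] /Sph0 c0.
  by apply: continuous_comp; [exact: section_continuous|exact/nml_cont/section_neq0].
(* Membership in [Q] depends only on the direction, and [q] carries rays to rays, so the covector
   can be normalized. *)
have QK u : u != 0 -> Q u <-> [set nml (q c) | c in Sph] (nml u).
  move=> u0; have nu0 : 0 < `|u| by rewrite normr_gt0.
  split=> [/horizontal_imageP[c c0 cu]|[c /Sph0 c0 cu]].
    have nc0 : 0 < `|c|^-1 by rewrite invr_gt0 normr_gt0.
    exists (nml c); first by rewrite /Sph /= normrZ normfV normr_id mulVf ?normr_eq0.
    rewrite /nml section_scale// cu normrZ gtr0_norm// invfM scalerA mulrAC.
    by rewrite mulVf ?mul1r// gt_eqF.
  have -> : u = (`|u| * `|q c|^-1) *: q c.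
    by rewrite -scalerA -[_ *: q c]/(nml (q c)) cu scalerA divff ?scale1r// gt_eqF.
  apply: horizontal_image_scale.
    by rewrite divr_gt0// normr_gt0 section_neq0.
  by apply/horizontal_imageP; exists c.
rewrite -openC openE => u /not_orP[Qu /eqP u0].
have : nbhs (nml u) (~` [set nml (q c) | c in Sph]).
  apply: open_nbhs_nbhs; split; first by rewrite openC.
  by move=> /(QK _ u0).
move/(nml_cont u u0) => H.
have H0 : \forall x \near u, x != 0 by exact: near_neq0.
near=> x; have x0 : x != 0 by near: x.
move=> [/(QK _ x0)|/eqP]; last by rewrite (negbTE x0).
by near: x.
Unshelve. all: by end_near. Qed.

Lemma horizontal_image_full u : u != 0 -> Q u.
Proof.
move=> u0; apply: contrapT => Qu.
(* Each point of [Q] lies on the ray opposite to [u]. Otherwise the segment from it to [u] avoids 0,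
   and the parameters mapped into [Q] form an open and closed part of the unit interval that
   contains 0 but not 1. *)
have neg u1 : Q u1 -> exists2 s : R, 0 < s & u1 = - s *: u.
  move=> Q1; pose g (t : R) := u1 + t *: (u - u1).
  have gc : continuous g.
    by move=> t; apply: cvgD; [exact: cvg_cst|apply: cvgZr_tmp; exact: cvg_id].
  have [t /andP[t0 t1] gt] : exists2 t, 0 <= t <= 1 & g t = 0.
    apply: contrapT => gn0.
    have : [set t | 0 <= t <= 1 /\ Q (g t)] = `[0, 1]%classic.
      apply: (@segment_connected R 0 1).
      - by exists 0; split; [rewrite lexx ler01|rewrite /g scale0r addr0].
      - exists (g @^-1` Q); first by apply: open_comp => //; exact: horizontal_image_open.
        by apply/seteqP; split => t /=; rewrite in_itv.
      - exists (g @^-1` (Q `|` [set 0])).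
          by apply: preimage_closed => //; exact: horizontal_image_closed.
        apply/seteqP; split => t /=; rewrite in_itv /=; first by move=> []; split => //; left.
        by move=> [t01 []// gt0]; case: gn0; exists t.
    move=> /seteqP[_ /(_ 1)] /=; rewrite in_itv /= lexx ler01 => /(_ isT)[_].
    by rewrite /g scale1r subrKC.
  have u10 := horizontal_image_neq0 Q1.
  have E : (1 - t) *: u1 = - t *: u.
    apply/eqP; rewrite -subr_eq0 -gt; apply/eqP/rowP => i; rewrite !mxE; ring.
  have t0' : 0 < t.
    rewrite lt_neqAle t0 andbT eq_sym; apply: contraNneq u10 => t00.
    by move: E; rewrite t00 subr0 scale1r oppr0 scale0r => ->.
  have t1' : 0 < 1 - t.
    rewrite subr_gt0 lt_neqAle t1 andbT; apply: contraNneq u0 => t11.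
    move: E; rewrite t11 subrr scale0r scaleN1r => /eqP.
    by rewrite eq_sym oppr_eq0.
  exists ((1 - t)^-1 * t); first by rewrite mulr_gt0// invr_gt0.
  by rewrite -mulrN -scalerA -E scalerA mulVf ?scale1r// gt_eqF.
have Nu0 : - u != 0 by rewrite oppr_eq0.
have Qq c : c != 0 -> Q (q c) by move=> c0; apply/horizontal_imageP; exists c.
have [s s0 Es] := neg _ (Qq _ u0).
have [s' s'0 Es'] := neg _ (Qq _ Nu0).
have [Hu Du] := vP u0; have [Hn Dn] := vP Nu0; have [An _] := Siso Hn.
have Eq : q u = (s / s') *: q (- u).
  by rewrite Es Es' scalerA mulrN divfK// gt_eqF.
pose w := u *m pinvmx S.
have wS : w *m S = u by rewrite /w -mulmxA mulVpmx ?mulmx1.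
(* On the preimage [w] of [u], the differential at [v u] takes the value [u *m u^T], whereas
   homogeneity of [l'] and the differential at [v (- u)] give [- (s / s')] times it. *)
have := Du w; rewrite derive_horizontal// -/(q u) Eq (derive_scale hl') ?divr_gt0//.
rewrite -derive_horizontal// Dn wS linearN mulmxN mxE mulrN => E.
have uu : 0 < (u *m u^T) 0 0.
  rewrite lt_neqAle mxE; apply/andP; split; last first.
    by apply: sumr_ge0 => i _; rewrite mxE -expr2 sqr_ge0.
  apply: contra_neq u0 => /esym/psumr_eq0P H; apply/rowP => i.
  have /eqP := H (fun i _ => ltac:(by rewrite mxE -expr2 sqr_ge0)) i isT.
  by rewrite [in X in X -> _]mxE -expr2 sqrf_eq0 [RHS]mxE => /eqP.
have : 0 < s / s' * (u *m u^T) 0 0 by rewrite mulr_gt0// divr_gt0.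
lra.
Qed.

End Existence.
End LinearSubmersion.

(** * From manifolds to a single tangent space *)

Section Slices.
Variables (R : realType) (V1 V2 W : normedModType R).

Lemma differentiable_pair_cst (x : V1) (w : V2) : differentiable (pair x) w.
Proof. by apply: differentiable_pair => //; exact: differentiable_cst. Qed.

(** The derivative of a slice along [v] is the slice of the derivative along [(0, v)], which allows
    induction on [k]. *)
Lemma Ck_slice k (U : set (V1 * V2)) (f : V1 * V2 -> W) (x : V1) :
  Ck k U f -> Ck k [set w | U (x, w)] (fun w => f (x, w)).
Proof.
elim: k f => [|k IHk] f /=.
  move=> fc w Uw; apply: (@continuous_comp _ _ _ (pair x) f); last exact: fc.
  exact/differentiable_continuous/differentiable_pair_cst.
move=> [df Df]; split=> [w Uw|v].
  apply: (@differentiable_comp _ _ _ _ (pair x) f); last exact: df.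
  exact: differentiable_pair_cst.
have -> : 'D_v (fun w => f (x, w)) = fun w => 'D_(0, v) f (x, w).
  apply/funext => w; rewrite /derive.
  apply: (congr1 (fun F : R -> W => lim (F @ 0^'))); apply/funext => h.
  congr (_ *: (f _ - _)) => /=.
  by rewrite -[RHS]/(h *: 0 + x, h *: v + w) scaler0 add0r.
exact: (IHk ('D_(0, v) f) (Df _)).
Qed.

End Slices.

Section ChartAt.
Variables (R : realType) (n : nat) (M : manifold R n) (p : M).
Let c := chart_at M p.

(** The preferred chart composed with its own inverse is the identity near [mcoord p], so its
    differential there is the identity. Abstracting over [P] lets the base point and the vector be
    replaced together. *)
Lemma tangent_of_chart_at (T : Type) (P : M -> 'rV[R]_n -> T) (w : 'rV[R]_n) :
  P (ch_inv c (mcoord p)) (tangent_of c (mcoord p) w) = P p w.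
Proof.
have pc : ch_dom c p := chart_at_dom p.
have codp : ch_cod c (mcoord p) by exists p.
have cp : ch_inv c (mcoord p) = p by exact: ch_mapK.
rewrite /tangent_of cp -/c; congr (P p _).
have [df _] : Ck 1 (ch_cod c `&` ch_inv c @^-1` ch_dom c) (ch_map c \o ch_inv c).
  by apply: atlas_compat; exact: chart_at_atlas.
rewrite -deriveE; last by apply: df; split => //=; rewrite cp.
rewrite (@near_eq_derive _ _ _ _ id) ?derive_id//.
near=> x; suff [q qc <-] : ch_cod c x by rewrite /= ch_mapK.
by near: x; apply: open_nbhs_nbhs; split => //; exact: ch_cod_open.
Unshelve. all: by end_near. Qed.

End ChartAt.

Section FundamentalTensor.
Variables (R : realType) (n : nat) (M : manifold R n).

Lemma fundamental_tensorE (L : forall p : M, tangent p -> R) (p : M) (v e h : tangent p) :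
  fundamental_tensor L v e h = 2^-1 * 'D_e ('D_h (L p : tangent p -> R^o)) v.
Proof.
have D (s : R) : derive1 (fun t : R => L p (v + s *: e + t *: h)) 0 =
    'D_h (L p : tangent p -> R^o) (v + s *: e).
  rewrite /derive1 /derive.
  apply: (congr1 (fun F : R -> R^o => lim (F @ 0^'))); apply/funext => t /=.
  by rewrite addr0 scale0r addr0 [t *: h + _]addrC.
have DD : derive1 (fun s : R => derive1 (fun t : R => L p (v + s *: e + t *: h)) 0) 0 =
    'D_e ('D_h (L p : tangent p -> R^o)) v.
  rewrite (_ : (fun s => _) = fun s => 'D_h (L p : tangent p -> R^o) (v + s *: e));
    last exact/funext.
  rewrite [LHS]/derive1 [RHS]/derive.
  apply: (congr1 (fun F : R -> R^o => lim (F @ 0^'))); apply/funext => t /=.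
  by rewrite addr0 scale0r addr0 [t *: e + _]addrC.
by rewrite /fundamental_tensor DD.
Qed.

(** In the preferred chart at [p] the tangent space is the slice over [mcoord p], so openness and
    smoothness restrict to it. *)
Lemma pseudo_finsler_norm (A : forall p : M, set (tangent p))
    (L : forall p : M, tangent p -> R) (hL : pseudo_finsler A L) (p : M) :
  pseudo_norm (A p) (L p).
Proof.
pose c := chart_at M p; have cA := chart_at_atlas p.
have codp : ch_cod c (mcoord p) by exists p => //; exact: chart_at_dom.
have AE : A p = [set w | in_chart A c (mcoord p, w)].
  have E (w : 'rV[R]_n) := tangent_of_chart_at p (A : M -> 'rV[R]_n -> Prop) w.
  apply/seteqP; split=> w; first by move=> Aw; split=> //; exact: (eq_ind _ id Aw _ (esym (E w))).
  by move=> [_ Aw]; exact: (eq_ind _ id Aw _ (E w)).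
have smooth k : Ck k (A p) (L p : tangent p -> R^o).
  have := Ck_slice (mcoord p) (L_smooth hL cA k); rewrite -AE.
  congr (Ck k (A p) _); apply/funext => w /=.
  exact: (tangent_of_chart_at p (L : M -> 'rV[R]_n -> R)).
have [d1 /all_and2[d2 c2]] := smooth 2.
apply: PseudoNorm.
- rewrite AE; apply: open_comp (adm_open hL cA) => w _.
  exact/differentiable_continuous/differentiable_pair_cst.
- by move=> v; exact: (adm_neq0 hL).
- by move=> v a; exact: (adm_cone hL).
- exact: d1.
- exact: d2.
- by move=> e w v; exact: (c2 w e).
- by move=> v a; exact: (L_homog hL).
- move=> v Av e De; apply: (L_nondeg hL Av) => h.
  by rewrite fundamental_tensorE De mulr0.
Qed.

Lemma legendreE (A : forall p : M, set (tangent p))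
    (L : forall p : M, tangent p -> R) (hL : pseudo_finsler A L) (p : M)
    (v w : tangent p) : A p v ->
  legendre L v w = 2^-1 * 'D_w (L p : tangent p -> R^o) v.
Proof.
move=> Av; rewrite /legendre fundamental_tensorE.
by rewrite (derive_euler (pseudo_finsler_norm hL p)).
Qed.

End FundamentalTensor.

(** * The differential of the submersion as a matrix *)

Section DifferentialMatrix.
Variables (R : realType) (m n : nat) (M : manifold R m) (B : manifold R n).
Variables (f : M -> B) (p : M).

Definition mdiff_mx : 'M[R]_(m, n) := lin1_mx (@mdiff _ _ _ _ _ f p).

Lemma mdiffE (v : tangent p) : mdiff f v = (v : 'rV[R]_m) *m mdiff_mx.
Proof. by rewrite -[LHS]mul_rV_lin1. Qed.

Lemma submersion_row_full : submersion f -> row_full mdiff_mx.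
Proof.
move=> [_ fsurj]; rewrite -sub1mx; apply/row_subP => i.
have [v <-] := fsurj p (row i 1%:M); rewrite mdiffE; exact: submxMl.
Qed.

End DifferentialMatrix.

Theorem lemma4 (R : realType) (m n : nat) (M : manifold R m) (B : manifold R n)
    (A : forall p : M, set (tangent p)) (L : forall p : M, tangent p -> R)
    (A' : forall b : B, set (tangent b)) (L' : forall b : B, tangent b -> R)
    (sigma : M -> B) (hsigma : pseudo_finsler_submersion A L A' L' sigma)
    (p : M) :
  (set_inj (A p) (@legendre R m M L p) ->
     forall u : tangent (sigma p), A' (sigma p) u ->
     forall v1 v2 : tangent p,
       horizontal A L sigma v1 -> mdiff sigma v1 = u ->
       horizontal A L sigma v2 -> mdiff sigma v2 = u ->
       v1 = v2) /\
  (set_bij (A p) (@nonzero_covectors R m M p) (@legendre R m M L p) ->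
     forall u : tangent (sigma p), A' (sigma p) u ->
     exists! v : tangent p, horizontal A L sigma v /\ mdiff sigma v = u).
Proof.
have hL := psub_total hsigma.
have hl := pseudo_finsler_norm hL p.
have hl' := pseudo_finsler_norm (psub_base hsigma) (sigma p).
pose S := mdiff_mx sigma p.
have Sfull : row_full S := submersion_row_full p (psub_subm hsigma).
have half0 : (2^-1 : R) != 0 by rewrite invr_eq0 pnatr_eq0.
have horE (v : tangent p) :
    horizontal A L sigma v <-> horizontal_row (A p) (L p) S v.
  have E w : A p v -> (fundamental_tensor L v v w = 0 <-> 'D_w (L p : tangent p -> R^o) v = 0).
    move=> Av; rewrite -[fundamental_tensor _ _ _ _]/(legendre L v w) (legendreE hL)//.
    by split=> [/eqP|->]; rewrite ?mulr0// mulf_eq0 (negbTE half0) => /eqP.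
  split=> -[Av vw]; split=> // w.
    by move=> wS; apply/(E _ Av)/vw; rewrite /vertical /= mdiffE.
  by rewrite /vertical /= mdiffE => wS; apply/(E _ Av)/vw.
have Siso x : horizontal_row (A p) (L p) S x ->
    A' (sigma p) (x *m S) /\ L p x = L' (sigma p) (x *m S).
  by move=> /horE /(psub_isom hsigma); rewrite mdiffE.
have Snondeg x : horizontal_row (A p) (L p) S x -> forall e : 'rV[R]_m, e *m S = 0 ->
    (forall w : 'rV[R]_m, w *m S = 0 -> 'D_e ('D_w (L p : tangent p -> R^o)) x = 0) -> e = 0.
  move=> /horE Hx e eS De; apply: (psub_nondeg hsigma Hx).
    by rewrite /vertical /= mdiffE.
  by move=> w; rewrite /vertical /= mdiffE fundamental_tensorE => /De ->; rewrite mulr0.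
have leg_inj : set_inj (A p) (@legendre R m M L p) -> forall v1 v2 : 'rV[R]_m,
    A p v1 -> A p v2 ->
    (forall w, 'D_w (L p : tangent p -> R^o) v1 = 'D_w (L p : tangent p -> R^o) v2) -> v1 = v2.
  move=> inj v1 v2 A1 A2 D; apply: (inj _ _ (mem_set A1) (mem_set A2)).
  by apply/funext => w; rewrite (legendreE hL _ A1) (legendreE hL _ A2) D.
have uniq : set_inj (A p) (@legendre R m M L p) ->
    forall u, forall v1 v2 : tangent p,
       horizontal A L sigma v1 -> mdiff sigma v1 = u ->
       horizontal A L sigma v2 -> mdiff sigma v2 = u -> v1 = v2.
  move=> inj u v1 v2 /horE H1 E1 /horE H2 E2.
  apply: (horizontal_row_unique hl hl' Sfull Siso Snondeg (leg_inj inj)) => //.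
  by rewrite -!mdiffE E1.
split=> [inj u _|bij u A'u]; first exact: uniq.
have inj := set_bij_inj bij.
have leg_surj (b : 'rV[R]_m) : b != 0 -> exists2 v : 'rV[R]_m, A p v &
    forall w, 'D_w (L p : tangent p -> R^o) v = (w *m b^T) 0 0.
  (* The factor [2^-1] reflects that the Legendre transform is half the differential. *)
  move=> b0; pose beta (w : tangent p) : R := 2^-1 * ((w : 'rV[R]_m) *m b^T) 0 0.
  have betaP : nonzero_covectors beta.
    split.
      by move=> k x y; rewrite /beta mulmxDl -scalemxAl !mxE; ring.
    have [i bi] : exists i, b 0 i != 0.
      apply: contrapT => /forallNP H; move/eqP: b0; apply; apply/rowP => i.
      by rewrite mxE; apply/eqP; have /negP := H i; rewrite negbK.
    exists ('e_i : 'rV[R]_m).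
    by rewrite /beta -rowE !mxE mulf_neq0.
  have [v Av vb] := set_bij_surj bij betaP.
  exists v => // w; have := congr1 (fun g => g w) vb.
  by rewrite (legendreE hL)// /beta => /(mulfI half0).
have [s sP] := horizontal_section Sfull leg_surj.
have [v /horE Hv vu] := horizontal_image_full hl hl' Sfull Siso Snondeg
  (leg_inj inj) sP (adm_neq0 (psub_base hsigma) A'u).
exists v; split; first by split=> //; rewrite mdiffE.
by move=> v' [Hv' v'u]; apply: (uniq inj u) => //; rewrite mdiffE.
Qed.
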